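(* The only non-identity automorphism of the monoid $\mathcal{P}_{\mathrm{fin},0}(\mathbb{Z})$ is the map given by $X\mapsto -X$ for every $X\in\mathcal{P}_{\mathrm{fin},0}(\mathbb{Z})$.
   Context: $\mathcal{P}_{\mathrm{fin},0}(\mathbb{Z})$ denotes the reduced finitary power monoid of the additive group $(\mathbb{Z},+)$: its elements are all finite subsets of $\mathbb{Z}$ containing $0$, its operation is setwise addition $X+Y=\{x+y : x\in X,\ y\in Y\}$, and its identity element is $\{0\}$. An automorphism is a bijective monoid homomorphism from $\mathcal{P}_{\mathrm{fin},0}(\mathbb{Z})$ to itself. For $X\subset\mathbb{Z}$, $-X=\{-x : x\in X\}$. *)

(* Defs.v *)
From HB Require Import structures.
From mathcomp Require Import all_boot all_order all_algebra.
From mathcomp Require Import finmap.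

Set Implicit Arguments.
Unset Strict Implicit.
Unset Printing Implicit Defensive.

Import GRing.Theory.

Local Open Scope fset_scope.
Local Open Scope ring_scope.

Definition sumset (X Y : {fset int}) : {fset int} :=
  [fset x + y | x in X, y in Y].

Definition negset (X : {fset int}) : {fset int} := [fset - x | x in X].

Lemma sumsetP (X Y : {fset int}) (z : int) :
  reflect (exists x y, [/\ x \in X, y \in Y & z = x + y]) (z \in sumset X Y).
Proof.
apply: (iffP idP) => [/imfset2P [x xX [y yY ->]]|[x [y [xX yY ->]]]].
  by exists x, y.
by apply/imfset2P; exists x => //; exists y.
Qed.

Lemma sumsetC (X Y : {fset int}) : sumset X Y = sumset Y X.
Proof.
by apply/fsetP=> z; apply/sumsetP/sumsetP => -[x [y [? ? ->]]];
  exists y, x; rewrite addrC.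
Qed.

Lemma sumsetA (X Y Z : {fset int}) :
  sumset X (sumset Y Z) = sumset (sumset X Y) Z.
Proof.
apply/fsetP=> t; apply/sumsetP/sumsetP.
  move=> [x [_ [xX /sumsetP [y [z [yY zZ ->]]] ->]]].
  exists (x + y), z; split=> //; last by rewrite addrA.
  by apply/sumsetP; exists x, y.
move=> [_ [z [/sumsetP [x [y [xX yY ->]]] zZ ->]]].
exists x, (y + z); split=> //; last by rewrite addrA.
by apply/sumsetP; exists y, z.
Qed.

Lemma sumset0 (X : {fset int}) : sumset [fset 0] X = X.
Proof.
apply/fsetP=> z; apply/sumsetP/idP => [[x [y [/fset1P -> yX ->]]]|zX].
  by rewrite add0r.
by exists 0, z; rewrite add0r fset11.
Qed.

(* The carrier of the reduced finitary power monoid of (Z, +). *)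
Record Pfin0Z : predArgType := MkPfin0Z {
  pfset :> {fset int};
  pfset0 : 0 \in pfset
}.

HB.instance Definition _ := [isSub for pfset].
HB.instance Definition _ := [Choice of Pfin0Z by <:].

Lemma zero_in_fset0 : (0 : int) \in [fset (0 : int)].
Proof. exact: fset11. Qed.

Lemma zero_in_sumset (X Y : Pfin0Z) : 0 \in sumset X Y.
Proof. by apply/sumsetP; exists 0, 0; rewrite !pfset0 addr0. Qed.

Lemma zero_in_negset (X : Pfin0Z) : 0 \in negset X.
Proof. by apply/imfsetP; exists 0; rewrite ?pfset0 //= oppr0. Qed.

Definition Pfin0Z_zero : Pfin0Z := MkPfin0Z zero_in_fset0.
Definition Pfin0Z_add (X Y : Pfin0Z) : Pfin0Z := MkPfin0Z (zero_in_sumset X Y).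
Definition Pfin0Z_neg (X : Pfin0Z) : Pfin0Z := MkPfin0Z (zero_in_negset X).

Lemma Pfin0Z_addA : associative Pfin0Z_add.
Proof. by move=> X Y Z; apply/val_inj/sumsetA. Qed.

Lemma Pfin0Z_addC : commutative Pfin0Z_add.
Proof. by move=> X Y; apply/val_inj/sumsetC. Qed.

Lemma Pfin0Z_add0 : left_id Pfin0Z_zero Pfin0Z_add.
Proof. by move=> X; apply/val_inj/sumset0. Qed.

(* A MathComp [nmodType] is an additively written commutative monoid: this
   makes [X + Y] the setwise sum and [0] the singleton {0} on [Pfin0Z].
   [Pfin0Z_neg] is not an inverse for this addition. *)
HB.instance Definition _ :=
  GRing.isNmodule.Build Pfin0Z Pfin0Z_addA Pfin0Z_addC Pfin0Z_add0.

Definition monoid_automorphism (M : nmodType) (f : M -> M) : Prop :=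
  nmod_morphism f /\ bijective f.

(* Main.v *)
(* Up to cancellation (X + Z = Y + Z for some Z) a set is determined by its
   minimum and maximum, so an automorphism f acts on pairs (- min, max)
   additively, and must fix or exchange {0, 1} and {-1, 0}.  Composing with
   negation, assume that f fixes both; then f fixes all intervals and preserves
   minima and maxima.  Comparing gaps, f fixes every {0, a} and every
   D = {-a, 0, N - a} with N a multiple of a > 0.  Put T = D + a = {0, a, N}
   and E = {0, a}.  Then 2 T + {-a, 0} = T + D + E; applying f and translating
   by a gives 2 f(T) + E = f(T) + T + E, hence 2 T + E = T + f^-1(T) + E, which
   forces f^-1(T) = T when N is large.  Finally, if a > 0 lies in X, then
   X + D = (X - a) + T, so f(X) + D = f(X - a) + T contains N, and for N large
   this is only possible if a lies in f(X). *)

Require Import Defs.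
From mathcomp Require Import all_boot all_order all_algebra.
From mathcomp Require Import finmap.
From mathcomp Require Import zify.

Import Order.TTheory GRing.Theory Num.Theory.
Local Open Scope fset_scope.
Local Open Scope ring_scope.

(** * Sums and the negation automorphism *)

Lemma addP (X Y : Pfin0Z) (z : int) :
  reflect (exists x y, [/\ x \in pfset X, y \in pfset Y & z = x + y])
          (z \in pfset (X + Y)).
Proof. exact: sumsetP. Qed.

Lemma Pfin0Z_eq (X Y : Pfin0Z) : pfset X =i pfset Y -> X = Y.
Proof. by move=> XY; apply/val_inj/fsetP. Qed.

Lemma mem_neg (X : Pfin0Z) (z : int) :
  (z \in pfset (Pfin0Z_neg X)) = (- z \in pfset X).
Proof.
apply/imfsetP/idP => [[x xX ->]|zX]; first by rewrite opprK.
by exists (- z); rewrite //= opprK.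
Qed.

Lemma Pfin0Z_negK : involutive Pfin0Z_neg.
Proof. by move=> X; apply: Pfin0Z_eq => z; rewrite !mem_neg opprK. Qed.

Lemma Pfin0Z_neg_morphism : nmod_morphism Pfin0Z_neg.
Proof.
split=> [|X Y]; apply: Pfin0Z_eq => z; rewrite mem_neg.
  by rewrite !inE oppr_eq0.
apply/addP/addP => -[x [y [xX yY e]]]; exists (- x), (- y).
  by rewrite !mem_neg !opprK -opprD -e opprK.
by rewrite -!mem_neg -opprD -e.
Qed.

(** * Two- and three-element sets, and arithmetic progressions *)

Fact triple_subproof (b c : int) : 0 \in [fset b; 0; c].
Proof. by rewrite !inE eqxx orbT. Qed.

Definition triple (b c : int) : Pfin0Z := MkPfin0Z (triple_subproof b c).

(** A degenerate triple, so that [triple_fixed] with [e = 0] also covers two-element sets. *)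
Definition doubleton (a : int) : Pfin0Z := triple 0 a.

Lemma in_triple (b c z : int) :
  (z \in pfset (triple b c)) = [|| z == b, z == 0 | z == c].
Proof. by rewrite !inE orbA. Qed.

Lemma in_doubleton (a z : int) : (z \in pfset (doubleton a)) = (z == 0) || (z == a).
Proof. by rewrite in_triple orbA orbb. Qed.

Lemma in_doubleton_muln (a z : int) (n : nat) :
  reflect (exists2 k : nat, (k <= n)%N & z = k%:Z * a) (z \in pfset (doubleton a *+ n)).
Proof.
apply: (iffP idP).
  elim: n z => [|n IHn] z; first by rewrite inE => /eqP ->; exists 0%N; rewrite ?mul0r.
  rewrite mulrS => /addP [x [y [+ /IHn [k kn ->] ->]]].
  rewrite in_doubleton => /orP [] /eqP ->.
    by exists k; [lia | rewrite add0r].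
  by exists k.+1; [lia | lia].
case=> k + ->; elim: n k => [|n IHn] k kn.
  have -> : k = 0%N by lia.
  by rewrite mul0r inE.
rewrite mulrS; apply/addP.
case: k kn => [|k] kn; first by exists 0, 0; rewrite !pfset0 mul0r addr0.
by exists a, (k%:Z * a); rewrite in_doubleton eqxx orbT IHn //; split=> //; lia.
Qed.

(** The set {-e a, ..., k a}, written as a sum so that a morphism fixing {-a, 0} and {0, a} fixes it
    by additivity. *)
Definition progression (a : int) (e k : nat) : Pfin0Z :=
  doubleton (- a) *+ e + doubleton a *+ k.

Lemma in_progression (a z : int) (e k : nat) :
  reflect (exists2 j : int, - e%:Z <= j <= k%:Z & z = j * a)
          (z \in pfset (progression a e k)).
Proof.
apply: (iffP (addP _ _ _)) => [[x [y []]]|[j jek ->]].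
  move=> /in_doubleton_muln [i ie ->] /in_doubleton_muln [j jk ->] ->.
  by exists (j%:Z - i%:Z); lia.
have [j_ge0|j_lt0] := lerP 0 j.
  exists 0, (j * a); rewrite pfset0 add0r; split=> //.
  by apply/in_doubleton_muln; exists `|j|%N; first lia; rewrite gez0_abs.
exists (j * a), 0; rewrite pfset0 addr0; split=> //.
by apply/in_doubleton_muln; exists `|j|%N; [lia | rewrite ltz0_abs // mulrNN].
Qed.

Lemma in_interval (z : int) (e k : nat) :
  (z \in pfset (progression 1 e k)) = (- e%:Z <= z <= k%:Z).
Proof.
apply/in_progression/idP => [[j ? ->]|]; first by rewrite mulr1.
by exists z; rewrite ?mulr1.
Qed.

(** * Minima and maxima *)

Definition bounds (X : Pfin0Z) (p q : nat) : Prop :=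
  [/\ - p%:Z \in pfset X, q%:Z \in pfset X
    & forall x, x \in pfset X -> - p%:Z <= x <= q%:Z].

(** As 0 lies in the set, the minimum is at most 0 and the maximum at least 0, so natural numbers
    suffice to record both. *)
Lemma bounds_exist (X : Pfin0Z) : exists p q, bounds X p q.
Proof.
have maxE (s : seq int) : exists2 q : nat, q%:Z \in 0 :: s & forall x, x \in s -> x <= q%:Z.
  elim: s => [|y s [q qs leq]]; first by exists 0%N.
  have [yq|qy] := lerP y q%:Z.
    exists q; first by move: qs; rewrite !inE => /orP [->|->]; rewrite ?orbT.
    by move=> x; rewrite inE => /orP [/eqP -> //|/leq].
  exists `|y|%N; first by rewrite gez0_abs ?inE ?eqxx ?orbT //; lia.
  by move=> x; rewrite inE => /orP [/eqP ->|/leq]; lia.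
have maxX (Y : Pfin0Z) : exists2 q : nat, q%:Z \in pfset Y & forall x, x \in pfset Y -> x <= q%:Z.
  have [q qY leq] := maxE (pfset Y); exists q => //.
  by move: qY; rewrite inE => /orP [/eqP ->|//]; rewrite pfset0.
have [q qX leq] := maxX X; have [p pX lep] := maxX (Pfin0Z_neg X).
rewrite mem_neg in pX; exists p, q; split=> // x xX.
by have := leq x xX; have := lep (- x); rewrite mem_neg opprK => /(_ xX); lia.
Qed.

Lemma bounds_unique {X p q p' q'} :
  bounds X p q -> bounds X p' q' -> p = p' /\ q = q'.
Proof.
move=> [pX qX le] [pX' qX' le'].
by have := le _ pX'; have := le _ qX'; have := le' _ pX; have := le' _ qX; lia.
Qed.

Lemma boundsD {X Y p q p' q'} :
  bounds X p q -> bounds Y p' q' -> bounds (X + Y) (p + p') (q + q').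
Proof.
move=> [pX qX le] [pY qY le']; split.
- by apply/addP; exists (- p%:Z), (- p'%:Z); split=> //; lia.
- by apply/addP; exists q%:Z, q'%:Z; split=> //; lia.
- by move=> _ /addP [x [y [/le + /le' + ->]]]; lia.
Qed.

Lemma bounds0 : bounds 0 0 0.
Proof. by split=> [||x]; rewrite inE // => /eqP ->. Qed.

Lemma boundsMn {X p q} (n : nat) :
  bounds X p q -> bounds (X *+ n) (n * p) (n * q).
Proof.
move=> bX; elim: n => [|n IHn]; first exact: bounds0.
by rewrite mulrS !mulSn; apply: boundsD.
Qed.

Lemma bounds_cancel {X Y Z p q} : X + Z = Y + Z -> bounds X p q -> bounds Y p q.
Proof.
move=> XYZ bX; have [r [s bZ]] := bounds_exist Z.
have [p' [q' bY]] := bounds_exist Y.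
have := boundsD bX bZ; rewrite XYZ => /bounds_unique /(_ (boundsD bY bZ)) [ep eq].
have -> : p = p' by lia.
by have -> : q = q' by lia.
Qed.

(* Up to cancellation, a set is determined by its minimum and maximum. *)
Lemma bounds_interval {X p q} : bounds X p q ->
  X + progression 1 (p + q) (p + q) = progression 1 p q + progression 1 (p + q) (p + q).
Proof.
move=> [pX qX le]; apply: Pfin0Z_eq => z; apply/addP/addP.
  move=> [x [y [xX yI ->]]]; exists x, y; split=> //.
  by rewrite in_interval le.
move=> [x [y []]]; rewrite !in_interval => xI yI ->.
(* The translates of the interval by the two endpoints -p and q of [X] already cover the whole
   sum. *)
have [h|h] := lerP (x + y) q%:Z.
  by exists (- p%:Z), (x + y + p%:Z); rewrite in_interval; split=> //; lia.
by exists q%:Z, (x + y - q%:Z); rewrite in_interval; split=> //; lia.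
Qed.

Lemma bounds_01 {X} : bounds X 0 1 -> X = doubleton 1.
Proof.
move=> [_ X1 le]; apply: Pfin0Z_eq => z; rewrite in_doubleton.
by apply/idP/orP => [/le|[/eqP ->|/eqP ->]]; rewrite ?pfset0 //; lia.
Qed.

Lemma bounds_10 {X} : bounds X 1 0 -> X = doubleton (- 1).
Proof.
move=> [X1 _ le]; apply: Pfin0Z_eq => z; rewrite in_doubleton.
by apply/idP/orP => [/le|[/eqP ->|/eqP ->]]; rewrite ?pfset0 //; lia.
Qed.

(** * Automorphisms and their action on minima and maxima *)

Lemma nmod_morphismMn {M N : nmodType} {f : M -> N} (x : M) (n : nat) :
  nmod_morphism f -> f (x *+ n) = f x *+ n.
Proof.
by move=> [f0 fD]; elim: n => [|n IHn]; rewrite ?mulr0n // !mulrS fD IHn.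
Qed.

Lemma monoid_automorphism_inv {M : nmodType} {f : M -> M} :
  monoid_automorphism f ->
  exists g, [/\ monoid_automorphism g, cancel f g & cancel g f].
Proof.
move=> [[f0 fD] [g fK gK]]; exists g; split=> //; split; last by exists f.
by split=> [|x y]; apply: (can_inj fK); rewrite ?fD !gK.
Qed.

Lemma monoid_automorphism_comp {M : nmodType} {f g : M -> M} :
  monoid_automorphism f -> monoid_automorphism g -> monoid_automorphism (f \o g).
Proof.
move=> [[f0 fD] fB] [[g0 gD] gB]; split; last exact: bij_comp.
by split=> [|x y] /=; rewrite ?g0 // gD fD.
Qed.

Lemma neg_automorphism : monoid_automorphism Pfin0Z_neg.
Proof.
by split; [exact: Pfin0Z_neg_morphism | exact: inv_bij Pfin0Z_negK].
Qed.

Lemma neg_doubleton (a : int) : Pfin0Z_neg (doubleton a) = doubleton (- a).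
Proof. by apply: Pfin0Z_eq => z; rewrite mem_neg !in_doubleton; lia. Qed.

Lemma bounds_triple (p q : nat) : bounds (triple (- p%:Z) q%:Z) p q.
Proof.
split=> [||x]; rewrite in_triple ?eqxx ?orbT //.
by case/or3P => /eqP ->; lia.
Qed.

Lemma bounds_doubleton1 : bounds (doubleton 1) 0 1.
Proof. exact: (bounds_triple 0 1). Qed.

Lemma bounds_doubletonN1 : bounds (doubleton (- 1)) 1 0.
Proof. by split=> [||x]; rewrite in_doubleton // => /orP [] /eqP ->. Qed.

(** By [bounds_interval], [X] and p {-1, 0} + q {0, 1} agree after adding a common summand. So do
    their images under [f], and cancellation preserves bounds. *)
Lemma bounds_image {f : Pfin0Z -> Pfin0Z} {X p q p1 q1 p2 q2} :
  nmod_morphism f -> bounds X p q ->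
  bounds (f (doubleton (- 1))) p1 q1 -> bounds (f (doubleton 1)) p2 q2 ->
  bounds (f X) (p * p1 + q * p2) (p * q1 + q * q2).
Proof.
move=> fM bX b1 b2; have [f0 fD] := fM.
have /(congr1 f) := bounds_interval bX; rewrite !fD => /esym/bounds_cancel; apply.
rewrite !(nmod_morphismMn _ _ fM).
exact: boundsD (boundsMn p b1) (boundsMn q b2).
Qed.

(** On bounds, [f] acts by a 2 by 2 matrix of natural numbers whose image contains (0, 1) and (1,
    0). Such a matrix is a permutation matrix, and the bounds (0, 1) or (1, 0) determine a set. *)
Lemma automorphism_units {f : Pfin0Z -> Pfin0Z} : monoid_automorphism f ->
  (f (doubleton 1) = doubleton 1 /\ f (doubleton (- 1)) = doubleton (- 1)) \/
  (f (doubleton 1) = doubleton (- 1) /\ f (doubleton (- 1)) = doubleton 1).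
Proof.
move=> fA; have [fM _] := fA.
have [g [gA fK gK]] := monoid_automorphism_inv fA.
have [p1 [q1 b1]] := bounds_exist (f (doubleton (- 1))).
have [p2 [q2 b2]] := bounds_exist (f (doubleton 1)).
have [p [q bp]] := bounds_exist (g (doubleton 1)).
have := bounds_image fM bp b1 b2; rewrite gK => /bounds_unique /(_ bounds_doubleton1) [e1 e2].
have [r [s br]] := bounds_exist (g (doubleton (- 1))).
have := bounds_image fM br b1 b2; rewrite gK => /bounds_unique /(_ bounds_doubletonN1) [e3 e4].
have : ((p1, q1, p2, q2) = (1, 0, 0, 1) \/ (p1, q1, p2, q2) = (0, 1, 1, 0))%N.
  have [/eqP|pq1] : (p * q1 = 1 \/ p * q1 = 0)%N by lia.
    rewrite muln_eq1 => /andP [/eqP ? /eqP ?]; subst; right.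
    have /eqP : (s * p2 = 1)%N by lia.
    rewrite muln_eq1 => /andP [/eqP ? /eqP ?]; subst.
    by congr (_, _, _, _); lia.
  have /eqP : (q * q2 = 1)%N by lia.
  rewrite muln_eq1 => /andP [/eqP ? /eqP ?]; subst; left.
  have /eqP : (r * p1 = 1)%N by lia.
  rewrite muln_eq1 => /andP [/eqP ? /eqP ?]; subst.
  by congr (_, _, _, _); lia.
case=> -[? ? ? ?]; subst; [left|right]; split.
- exact: bounds_01.
- exact: bounds_10.
- exact: bounds_10.
- exact: bounds_01.
Qed.

(** * Automorphisms fixing {0, 1} and {-1, 0} *)

Definition unit_fixing (f : Pfin0Z -> Pfin0Z) : Prop :=
  [/\ monoid_automorphism f, f (doubleton 1) = doubleton 1 & f (doubleton (- 1)) = doubleton (- 1)].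

Lemma unit_fixing_inv {f g} :
  monoid_automorphism g -> cancel f g -> unit_fixing f -> unit_fixing g.
Proof.
move=> gA fK [_ f1 fN1]; split; first exact: gA.
  by rewrite -[in LHS]f1 fK.
by rewrite -[in LHS]fN1 fK.
Qed.

(** Carries results about positive integers over to negative ones. *)
Lemma unit_fixing_conj {f} :
  unit_fixing f -> unit_fixing (Pfin0Z_neg \o f \o Pfin0Z_neg).
Proof.
move=> [fA f1 fN1]; split=> [||/=].
- have negA := neg_automorphism.
  exact: monoid_automorphism_comp (monoid_automorphism_comp negA fA) negA.
- by rewrite /= neg_doubleton fN1 neg_doubleton opprK.
- by rewrite neg_doubleton opprK f1 neg_doubleton.
Qed.

Lemma bounds_fixed {f X p q} : unit_fixing f -> bounds X p q -> bounds (f X) p q.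
Proof.
move=> [[fM _] f1 fN1] bX.
have := @bounds_image f X p q 1 0 0 1 fM bX.
rewrite f1 fN1 !muln1 !muln0 addn0 add0n; apply.
  exact: bounds_doubletonN1.
exact: bounds_doubleton1.
Qed.

(** * Fixed doubletons and triples, by comparison of gaps *)

Lemma triple_add_doubleton (a e k : nat) : (e <= 1)%N -> (2 <= k)%N ->
  triple (- e%:Z * a%:Z) (k%:Z * a%:Z) + doubleton a *+ k = progression a e (k + k).
Proof.
move=> e1 k2; apply: Pfin0Z_eq => z; apply/addP/in_progression.
  move=> [x [y [+ /in_doubleton_muln [j jk ->] ->]]]; rewrite in_triple.
  case/or3P => /eqP ->; last 1 first.
  - by exists (k%:Z + j%:Z); [lia | rewrite mulrDl].
  - by exists (- e%:Z + j%:Z); [lia | rewrite mulrDl].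
  - by exists j%:Z; [lia | rewrite add0r].
move=> [j jek ->].
(* The points 0 and k a of the triple yield the multiples from 0 to 2 k a; as e <= 1, a negative one
   can only be -e a itself. *)
have [j0|j0] := ltrP j 0.
  exists (j * a%:Z), 0; rewrite pfset0 addr0 in_triple; split=> //.
  by have jE : j = - e%:Z; [lia | rewrite jE eqxx].
have [jk|jk] := lerP j k%:Z.
  exists 0, (j * a%:Z); rewrite pfset0 add0r; split=> //.
  by apply/in_doubleton_muln; exists `|j|%N; [lia | rewrite gez0_abs].
exists (k%:Z * a%:Z), ((j - k%:Z) * a%:Z); split; last by rewrite -mulrDl addrC subrK.
  by rewrite in_triple eqxx !orbT.
by apply/in_doubleton_muln; exists `|(j - k%:Z)|%N; [lia | rewrite gez0_abs //; lia].
Qed.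

(* An element [j a] of the image with [0 < j < k] would fill the gap of the
   triple between [0] and [k a]: adding the fixed set [{0, a, ..., (k - 2) a}]
   to the image, but not to the triple, would give a full progression. *)
Lemma triple_fixed {f} {a e k : nat} : unit_fixing f ->
  f (doubleton a%:Z) = doubleton a%:Z -> f (doubleton (- a%:Z)) = doubleton (- a%:Z) ->
  (0 < a)%N -> (e <= 1)%N -> (2 <= k)%N ->
  f (triple (- e%:Z * a%:Z) (k%:Z * a%:Z)) = triple (- e%:Z * a%:Z) (k%:Z * a%:Z).
Proof.
move=> fU fa fNa a0 e1 k2; have [[[f0 fD] fB] _ _] := fU.
have fM : nmod_morphism f by [].
set D := triple _ _.
have fprog m n : f (progression a m n) = progression a m n.
  by rewrite /progression fD !(nmod_morphismMn _ _ fM) fa fNa.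
have bD : bounds D (e * a) (k * a).
  have -> : D = triple (- (e * a)%N%:Z) (k * a)%N%:Z by rewrite !PoszM -mulNr.
  exact: bounds_triple.
have [fDl fDr fDle] := bounds_fixed fU bD.
(* Since 0 lies in {0, a, ..., k a}, [f D] is contained in its sum with this fixed set, which is a
   fixed progression of multiples of a. The bounds of [f D] then limit [j]. *)
have fD_mul z : z \in pfset (f D) -> exists2 j : int, - e%:Z <= j <= k%:Z & z = j * a%:Z.
  move=> zD; have : z \in pfset (progression a e (k + k)).
    rewrite -fprog -triple_add_doubleton // fD; apply/addP.
    by exists z, 0; rewrite pfset0 addr0.
  case/in_progression => j jek zE; exists j => //.
  have := fDle z zD; rewrite zE !PoszM -mulNr !ler_pM2r //; lia.
have fD_gap j : 1 <= j <= k%:Z - 1 -> j * a%:Z \notin pfset (f D).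
  move=> jk; apply/negP => jD.
  have fE : f D + doubleton a *+ (k - 2) = progression a e (k + (k - 2)).
    apply: Pfin0Z_eq => z; apply/addP/in_progression.
      move=> [x [y [/fD_mul [i ik ->] /in_doubleton_muln [l lk ->] ->]]].
      by exists (i + l%:Z); [lia | rewrite mulrDl].
    move=> [i ik ->].
    (* Each i a is reached from one of -e a, 0, j a, k a by at most k - 2 steps of length a; the
       hypothetical element j a serves for i = k - 1. *)
    have split_at l : l * a%:Z \in pfset (f D) -> 0 <= i - l <= k%:Z - 2 ->
        exists x y, [/\ x \in pfset (f D), y \in pfset (doubleton a *+ (k - 2)) & i * a%:Z = x + y].
      move=> lD il; exists (l * a%:Z), ((i - l) * a%:Z); split=> //; last by rewrite -mulrDl addrC subrK.
      by apply/in_doubleton_muln; exists `|(i - l)|%N; [lia | rewrite gez0_abs //; lia].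
    have [?|?] := ltrP i 0.
      by apply: (split_at (- e%:Z)); [rewrite mulNr -PoszM | lia].
    have [?|?] := lerP i (k%:Z - 2).
      by apply: (split_at 0); [rewrite mul0r pfset0 | lia].
    have [?|?] := ltrP i k%:Z; first by apply: (split_at j) => //; lia.
    by apply: (split_at k%:Z); [rewrite -PoszM | lia].
  have := fE; rewrite -fprog -fa -(nmod_morphismMn _ _ fM) -fD => /(bij_inj fB) DE.
  (* The original triple misses (k - 1) a: from -e a and 0 one gets at most to (k - 2) a, and k a
     lies beyond. *)
  have : (k%:Z - 1) * a%:Z \in pfset (D + doubleton a *+ (k - 2)).
    by rewrite DE; apply/in_progression; exists (k%:Z - 1) => //; lia.
  case/addP => x [y [+ /in_doubleton_muln [l lk ->] /eqP]]; rewrite in_triple.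
  have aN0 : a%:Z != 0 by lia.
  case/or3P => /eqP ->; rewrite ?add0r -?mulrDl (inj_eq (mulIf aN0)); lia.
apply: Pfin0Z_eq => z; apply/idP/idP => zD.
  have [j jk zE] := fD_mul z zD; rewrite in_triple zE.
  have : ~~ (1 <= j <= k%:Z - 1) by apply/negP => /fD_gap; rewrite -zE zD.
  move=> jN; have : [|| j == - e%:Z, j == 0 | j == k%:Z] by lia.
  by case/or3P => /eqP ->; rewrite ?mul0r eqxx ?orbT.
move: zD; rewrite in_triple => /or3P [] /eqP ->; rewrite ?pfset0 //.
by rewrite mulNr -PoszM.
Qed.

Lemma doubleton_nat_fixed {f} (a : nat) : unit_fixing f -> f (doubleton a%:Z) = doubleton a%:Z.
Proof.
move=> fU; have [[[f0 _] _] f1 fN1] := fU.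
case: a => [|[|a]] //.
  have -> : doubleton 0 = 0 by apply: Pfin0Z_eq => z; rewrite in_doubleton orbb inE.
  exact: f0.
by have := @triple_fixed f 1 0 a.+2 fU f1 fN1 isT isT isT; rewrite mul0r mulr1.
Qed.

Lemma doubleton_fixed {f} (a : int) : unit_fixing f -> f (doubleton a) = doubleton a.
Proof.
move=> fU; have [a0|a0] := leP 0 a.
  by rewrite -(gez0_abs a0); apply: doubleton_nat_fixed.
have -> : a = - `|a|%N%:Z by lia.
have := doubleton_nat_fixed `|a|%N (unit_fixing_conj fU).
by move=> /(congr1 Pfin0Z_neg); rewrite /= Pfin0Z_negK neg_doubleton.
Qed.

(** * Translation, and triples {0, a, c a} *)

Definition translated (s : int) (X' X : Pfin0Z) : Prop :=
  forall z, (z \in pfset X') = (z + s \in pfset X).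

Lemma translated_add {s X' X} (Y : Pfin0Z) :
  translated s X' X -> translated s (Y + X') (Y + X).
Proof.
move=> XX' z; apply/addP/addP => -[y [x [yY xX e]]].
  by exists y, (x + s); rewrite -XX'; split=> //; rewrite e addrA.
exists y, (x - s); rewrite XX' subrK; split=> //.
by rewrite addrA -e addrK.
Qed.

Lemma translated_inj {s X' Y' X Y} :
  translated s X' X -> translated s Y' Y -> X = Y -> X' = Y'.
Proof. by move=> XX' YY' e; apply: Pfin0Z_eq => z; rewrite XX' YY' e. Qed.

Lemma translated_fun {s X' Y' X Y} :
  translated s X' X -> translated s Y' Y -> X' = Y' -> X = Y.
Proof.
by move=> XX' YY' e; apply: Pfin0Z_eq => z; rewrite -(subrK s z) -XX' -YY' e.
Qed.

(** The condition that s lies in [X] puts 0 in the translate; this is why translation is a relation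
    and not an operation on the carrier. *)
Lemma translated_exists {s} {X : Pfin0Z} :
  s \in pfset X -> exists X', translated s X' X.
Proof.
move=> sX; have X'0 : 0 \in [fset x - s | x in pfset X].
  by apply/imfsetP; exists s; rewrite ?subrr.
exists (MkPfin0Z X'0) => z; apply/imfsetP/idP => [[x xX ->]|zX]; first by rewrite subrK.
by exists (z + s); rewrite ?addrK.
Qed.

Lemma translated_doubleton (a : int) : translated a (doubleton (- a)) (doubleton a).
Proof. by move=> z; rewrite !in_doubleton; lia. Qed.

Lemma translated_triple (a b : int) :
  translated a (triple (- a) (b - a)) (triple a b).
Proof. by move=> z; rewrite !in_triple; lia. Qed.

(** The case e = 1, k = c - 1 of [triple_fixed]; c >= 3 gives k >= 2. *)
Lemma straddling_triple_fixed {f} {a c : nat} :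
  unit_fixing f -> (0 < a)%N -> (3 <= c)%N ->
  f (triple (- a%:Z) ((c * a)%N%:Z - a%:Z)) = triple (- a%:Z) ((c * a)%N%:Z - a%:Z).
Proof.
move=> fU a0 c3.
have := @triple_fixed f a 1 c.-1 fU (doubleton_fixed _ fU) (doubleton_fixed _ fU) a0 isT.
have -> : - 1%N%:Z * a%:Z = - a%:Z by rewrite mulN1r.
have -> : c.-1%:Z * a%:Z = (c * a)%N%:Z - a%:Z by rewrite -{2}(@prednK c) ?mulSn; lia.
by apply; lia.
Qed.

Lemma triple_image_relation {f} {a c : nat} :
  unit_fixing f -> (0 < a)%N -> (3 <= c)%N ->
  let X := triple a%:Z (c * a)%N%:Z in
  f X + (f X + doubleton a%:Z) = f X + (X + doubleton a%:Z).
Proof.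
move=> fU a0 c3 X; have [[[_ fD] _] _ _] := fU.
set D := triple (- a%:Z) ((c * a)%N%:Z - a%:Z).
have tD : translated a D X by apply: translated_triple.
have tE := translated_doubleton a.
have DE : f D = D := straddling_triple_fixed fU a0 c3.
(* Both sides are the translate by -a of X + X + {0, a}. *)
have XE : X + (X + doubleton (- a%:Z)) = X + (doubleton a%:Z + D).
  apply: translated_inj (translated_add X (translated_add X tE))
           (translated_add X (translated_add (doubleton a) tD)) _.
  by rewrite (addrC (doubleton _)).
have /(congr1 f) := XE; rewrite !fD !(doubleton_fixed _ fU) DE.
move/(translated_fun (translated_add (f X) (translated_add (f X) tE))
        (translated_add (f X) (translated_add (doubleton a) tD))).
by rewrite (addrC (doubleton _)).
Qed.

(** With E = {0, a}, the inverse [g] satisfies X + X + E = X + g(X) + E. This confines [g X] to [X],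
    and equality follows because {0, c a} is already fixed. *)
Lemma positive_triple_fixed {f} {a c : nat} :
  unit_fixing f -> (0 < a)%N -> (6 <= c)%N ->
  f (triple a%:Z (c * a)%N%:Z) = triple a%:Z (c * a)%N%:Z.
Proof.
move=> fU a0 c6; have [fA _ _] := fU; have [[_ fD] _] := fA.
have [g [gA fK gK]] := monoid_automorphism_inv fA.
have gU := unit_fixing_inv gA fK fU; have [[_ gD] _] := gA.
have := @triple_image_relation f a c fU a0 (leq_trans _ c6) => /(_ isT) /=.
set X := triple _ _ => /(congr1 g); rewrite !gD !fK (doubleton_fixed _ gU) => XE.
suff gX : g X = X by rewrite -{1}gX gK.
have N6 : (6 * a <= c * a)%N by rewrite leq_mul2r c6 orbT.
have bX : bounds X 0 (c * a) by split=> [||x]; rewrite in_triple; lia.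
have [_ gXN gXle] := bounds_fixed gU bX.
(* Both z and z + 2a lie in X + X + E, as E is contained in [X]. The elements of this sum up to c a
   are 0, a, 2a, 3a and c a; z = 2a and z = 3a are excluded because 4a and 5a fall in the gap below
   c a >= 6a. *)
have gX_sub z : z \in pfset (g X) -> z \in pfset X.
  move=> zX; have zle := gXle z zX.
  have memXE e : e \in pfset (doubleton a%:Z + doubleton a%:Z) -> z + e \in pfset (X + (X + doubleton a%:Z)).
    move=> eE; rewrite XE; case/addP: eE => x [y [xE yE ->]].
    apply/addP; exists x, (z + y); split; last by rewrite addrCA.
      by move: xE; rewrite in_doubleton in_triple; lia.
    by apply/addP; exists z, y.
  have memE e : e = 0 \/ e = a%:Z + a%:Z -> e \in pfset (doubleton a%:Z + doubleton a%:Z).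
    by case=> ->; apply/addP; [exists 0, 0 | exists a%:Z, a%:Z]; rewrite !in_doubleton eqxx ?orbT.
  have mem3 t : t \in pfset (X + (X + doubleton a%:Z)) ->
      exists x y e, [/\ x \in pfset X, y \in pfset X, e \in pfset (doubleton a%:Z) & t = x + (y + e)].
    by move=> /addP [x [_ [xX /addP [y [e [yX eE ->]]] ->]]]; exists x, y, e.
  have [x [y [e []]]] := mem3 _ (memXE _ (memE _ (or_introl erefl))).
  have [x' [y' [e' []]]] := mem3 _ (memXE _ (memE _ (or_intror erefl))).
  rewrite !in_doubleton !in_triple; lia.
apply: Pfin0Z_eq => z; apply/idP/idP; first exact: gX_sub.
rewrite in_triple => /or3P [] /eqP ->; rewrite ?pfset0 //.
(* Without a, [g X] would be {0, c a}, which [f] fixes, so [X] itself would lack a. *)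
apply: contraT => aN.
have gXE : g X = doubleton (c * a)%N%:Z.
  apply: Pfin0Z_eq => t; rewrite in_doubleton; apply/idP/orP => [tX|[] /eqP ->]; rewrite ?pfset0 //.
  have := gX_sub t tX; rewrite in_triple => /or3P [/eqP tE| |]; auto.
  by move: aN; rewrite -tE tX.
have XN : X = doubleton (c * a)%N%:Z by rewrite -(gK X) gXE (doubleton_fixed _ fU).
have : a%:Z \in pfset X by rewrite in_triple eqxx.
by rewrite XN in_doubleton; lia.
Qed.

(** * Elements preserved by automorphisms, and the classification *)

Lemma pos_mem_image {f} {X : Pfin0Z} {a : nat} :
  unit_fixing f -> (0 < a)%N -> a%:Z \in pfset X -> a%:Z \in pfset (f X).
Proof.
move=> fU a0 aX; have [[[_ fD] _] _ _] := fU.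
have [X' tX] := translated_exists aX.
have [p [q [_ _ le]]] := bounds_exist (f X).
(* The factor q + 6 makes N exceed the maximum q of [f X] and meets the requirement c >= 6. *)
pose N := ((q + 6) * a)%N.
have Nq : (q + 6 <= N)%N by rewrite leq_pmulr.
(* Both sides are the translate by -a of X + {0, a, N}. *)
have /(congr1 f) : X + triple (- a%:Z) (N%:Z - a%:Z) = triple a%:Z N%:Z + X'.
  apply: translated_inj (translated_add X (translated_triple a N)) (translated_add _ tX) _.
  exact: addrC.
rewrite !fD (straddling_triple_fixed fU) //; last lia.
rewrite (positive_triple_fixed fU) //; last lia.
move=> E; have : N%:Z \in pfset (triple a%:Z N%:Z + f X').
  by apply/addP; exists N%:Z, 0; rewrite pfset0 addr0 in_triple eqxx !orbT.
(* In N = x + y with x <= q < N, the choices y = -a and y = 0 make x too large, so y = N - a and x =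
   a. *)
rewrite -E => /addP [x [y [xX + e]]]; rewrite in_triple => yE.
have xle := le x xX.
by have -> : a%:Z = x by lia.
Qed.

Lemma mem_image {f} {X : Pfin0Z} {a : int} :
  unit_fixing f -> a \in pfset X -> a \in pfset (f X).
Proof.
move=> fU; have [a0|a0|->] := ltrgtP a 0; last by rewrite !pfset0.
  have -> : a = - `|a|%N%:Z by lia.
  rewrite -!mem_neg => aX.
  have := pos_mem_image (unit_fixing_conj fU) _ aX.
  by rewrite /= Pfin0Z_negK; apply; lia.
have -> : a = `|a|%N%:Z by lia.
by apply: pos_mem_image => //; lia.
Qed.

Lemma unit_fixing_id {f} : unit_fixing f -> f =1 id.
Proof.
move=> fU X; have [fA _ _] := fU; have [g [gA fK _]] := monoid_automorphism_inv fA.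
have gU := unit_fixing_inv gA fK fU.
(* One inclusion comes from [f], the other from its inverse. *)
apply: Pfin0Z_eq => z; apply/idP/idP; last exact: mem_image.
by move/(mem_image gU); rewrite fK.
Qed.

Lemma monoid_automorphism_eq {M : nmodType} {f g : M -> M} :
  f =1 g -> monoid_automorphism g -> monoid_automorphism f.
Proof.
move=> fg [[g0 gD] gB]; split; last exact: eq_bij gB _ (fsym fg).
by split=> [|x y]; rewrite !fg.
Qed.

Theorem theorem1p3 (f : Pfin0Z -> Pfin0Z) :
  (monoid_automorphism f /\ ~ (f =1 id)) <-> f =1 Pfin0Z_neg.
Proof.
split=> [[fA fNid]|fN].
  have [[f1 fN1]|[f1 fN1]] := automorphism_units fA.
    by case: fNid; apply: unit_fixing_id.
  (* When [f] exchanges {0, 1} and {-1, 0}, following it by negation restores both. *)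
  have nfU : unit_fixing (Pfin0Z_neg \o f).
    split; first exact: monoid_automorphism_comp neg_automorphism fA.
      by rewrite /= f1 neg_doubleton opprK.
    by rewrite /= fN1 neg_doubleton.
  by move=> X; apply: (can_inj Pfin0Z_negK); rewrite Pfin0Z_negK; apply: (unit_fixing_id nfU).
split; first exact: monoid_automorphism_eq fN neg_automorphism.
move=> /(_ (doubleton 1)); rewrite fN neg_doubleton => E.
have : (1 : int) \in pfset (doubleton (- 1)) by rewrite E in_doubleton.
by rewrite in_doubleton.
Qed.
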